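(* If $G$ is a finite abelian group and $r$ is a positive multiple of $\exp(G)$, then $$\tau\big(s_r(G),\, r\big) \;\leq\; \frac{1}{|G|} .$$
   Context: $\exp(G)$ is the exponent of $G$ (the least common multiple of the orders of its elements). $s_r(G)$ is the smallest integer $s$ such that every sequence of length $s$ over $G$ (repetitions allowed) has a zero-sum subsequence of length $r$ (a subsequence, not necessarily of consecutive terms, whose terms sum to $0$). An $r$-graph is a pair $H=(V(H),E(H))$ where $V(H)$ is a finite set of vertices and $E(H)$ is a collection of $r$-subsets of $V(H)$. The independence number $\alpha(H)$ is the maximum size of a subset of $V(H)$ which contains no edges of $H$. The degree of a subset $A\subseteq V(H)$ is the number of edges of $H$ containing $A$, and $\Delta_l(H)$ is the maximum degree among $l$-subsets of $V(H)$. Let $$T_{r-1}(n,k,r)=\min\{\Delta_{r-1}(H): H \text{ is an } r\text{-graph with } |V(H)|=n,\ \alpha(H)<k\}.$$ The codegree Turán density is $\tau(k,r)=\lim_{n\to\infty} T_{r-1}(n,k,r)/(n-r+1)$; this limit is known to exist. *)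

(* Defs.v *)
From HB Require Import structures.
From mathcomp Require Import all_boot all_order all_algebra all_fingroup all_solvable.
From mathcomp Require Import boolp reals topology normedtype sequences.

Set Implicit Arguments.
Unset Strict Implicit.
Unset Printing Implicit Defensive.

Import Order.TTheory GRing.Theory Num.Theory.
Import numFieldNormedType.Exports.

Section Hypergraphs.
Variable V : finType.
Implicit Types (H : {set {set V}}) (A S : {set V}).

Definition is_rgraph (r : nat) H : bool := [forall e in H, #|e| == r].

Definition independent H S : bool := [forall e in H, ~~ (e \subset S)].

Definition alpha H : nat := \max_(S : {set V} | independent H S) #|S|.

Definition degree H A : nat := #|[set e in H | A \subset e]|.

Definition Delta (l : nat) H : nat := \max_(A : {set V} | #|A| == l) degree H A.

Definition complete_rgraph (r : nat) : {set {set V}} := [set e : {set V} | #|e| == r].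

Lemma complete_rgraphP (k r : nat) : 0 < r <= k ->
  is_rgraph r (complete_rgraph r) && (alpha (complete_rgraph r) < k).
Proof.
case/andP=> r0 rk; apply/andP; split.
  by apply/forall_inP => e; rewrite inE.
apply: leq_trans rk; rewrite -[r in _ < r](prednK r0) ltnS.
apply/bigmax_leqP => S /forall_inP indS; rewrite -ltnS (prednK r0) ltnNge.
apply/negP => rS.
have [e eS er] : exists2 e : {set V}, e \subset S & #|e| = r.
  have : 0 < #|[set e : {set V} | e \subset S & #|e| == r]|.
    by rewrite cards_draws bin_gt0.
  by case/card_gt0P=> e; rewrite inE => /andP[? /eqP ?]; exists e.
by have := indS e; rewrite inE er eqxx eS => /(_ isT).
Qed.

End Hypergraphs.

(* [complete_rgraph] is only the default value of [arg min]: it is reached as a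
   junk value only when no r-graph on n vertices has independence number below
   k, which does not happen for k >= r > 0: see [complete_rgraphP]. *)
Definition T_codegree (n k r : nat) : nat :=
  Delta r.-1 [arg min_(H < complete_rgraph 'I_n r
                       | is_rgraph r H && (alpha H < k)) Delta r.-1 H].

(* For k >= r > 0 the limit is known to exist, so the default value of the total
   operator [limn] plays no role. The denominator is computed in R, hence without
   truncated subtraction. *)
Definition codegree_density (R : realType) (k r : nat) : R :=
  limn (fun n : nat => ((T_codegree n k r)%:R / (n%:R - r%:R + 1) : R)%R).

Section ZeroSum.
Variable G : finZmodType.

(* The order of the terms is irrelevant, so order-preserving [subseq] loses
   nothing; repeated terms count with their multiplicity. *)
Definition zero_sum_forced (r s : nat) : bool :=
  [forall t : s.-tuple G,
    [exists u : r.-tuple G, subseq u t && ((\sum_(x <- u) x)%R == 0%R)]].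

(* The junk value 0 is not taken when r is a multiple of the exponent:
   see [zero_sum_forced_ex]. *)
Definition zero_sum_const (r : nat) : nat :=
  if pselect (exists s, zero_sum_forced r s) is left ex then ex_minn ex else 0.

Lemma zero_sum_forced_ex (r : nat) :
  exponent [set: G] %| r -> exists s, zero_sum_forced r s.
Proof.
move=> hr; exists (#|G| * r).+1; apply/forallP => t.
have [x hx] : exists x : G, r <= count_mem x t.
  apply/existsP; apply: contraT; rewrite negb_exists => /forallP lt_r.
  suff : size t <= #|G| * r by rewrite size_tuple ltnn.
  rewrite -sum1_size (partition_big id xpredT) //=.
  apply: (@leq_trans (\sum_(x : G) r)); last by rewrite sum_nat_const.
  by apply: leq_sum => x _; rewrite sum1_count ltnW // ltnNge lt_r.
apply/existsP; exists [tuple of nseq r x]; apply/andP; split.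
  apply: (@subseq_trans _ [seq y <- t | pred1 x y]); last exact: filter_subseq.
  have /all_pred1P -> : all (pred1 x) [seq y <- t | pred1 x y] by exact: filter_all.
  rewrite size_filter -(subnKC hx) /= nseqD; exact: prefix_subseq.
rewrite big_nseq -Monoid.iteropE /=.
have := dvdn_trans (dvdn_exponent (in_setT x)) hr.
by rewrite order_dvdn FinRing.zmodXgE.
Qed.

End ZeroSum.

(* Main.v *)
Require Import Defs.
From mathcomp Require Import all_boot all_order all_algebra all_fingroup all_solvable.
From mathcomp Require Import reals.
From mathcomp Require Import ring boolp classical_sets topology normedtype sequences.

(** Colour the [n] vertices by the elements of [G] as evenly as possible and take
    as edges the [r]-sets of colour sum zero.

    The colours of [zero_sum_const G r] distinct vertices form a sequence which,
    by definition of that constant, has a zero-sum subsequence of length [r]: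
    these terms sit at distinct vertices, hence form an edge.  So no set of that
    size is independent ([alpha_zero_sum_rgraph]).

    An [(r-1)]-set [A] is completed to an edge exactly by the vertices outside [A]
    whose colour is the opposite of the colour sum of [A].  The codegree of [A] is
    thus at most the size of one colour class ([Delta_zero_sum_rgraph]), which is
    at most [n / |G| + 1].

    Dividing this bound on [T_codegree] by [n - r + 1] and letting [n] tend to
    infinity gives [1 / |G|]. *)

Set Implicit Arguments.
Unset Strict Implicit.
Unset Printing Implicit Defensive.

Import Order.TTheory GRing.Theory Num.Theory.
Import numFieldNormedType.Exports.

Section ZeroSumHypergraph.
Variables (G : finZmodType) (V : finType) (f : V -> G).

Definition zero_sum_rgraph (r : nat) : {set {set V}} :=
  [set e : {set V} | (#|e| == r) && ((\sum_(v in e) f v)%R == 0%R)].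

Lemma zero_sum_rgraph_rgraph (r : nat) : is_rgraph r (zero_sum_rgraph r).
Proof. by apply/forall_inP => e; rewrite inE => /andP[]. Qed.

(** The colours met along an enumeration of [S] form a sequence over [G] in which
    a colour is repeated once for each vertex carrying it, so that a subsequence
    of colours lifts to a set of distinct vertices. *)
Lemma independent_zero_sum_rgraph (r s : nat) (S : {set V}) :
  zero_sum_forced G r s -> independent (zero_sum_rgraph r) S -> #|S| < s.
Proof.
move=> /forallP forced indS; rewrite ltnNge; apply/negP => leS.
have size_t : size (take s [seq f v | v <- enum S]) == s.
  by rewrite size_takel // size_map -cardE.
have /existsP[u /andP[sub_u /eqP sum_u]] := forced (Tuple size_t).
have {sub_u} /subseqP[m _ def_u] := subseq_trans sub_u (take_subseq _ s).
rewrite -map_mask in def_u.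
have uniq_vs : uniq (mask m (enum S)) by rewrite mask_uniq ?enum_uniq.
pose e := [set v in mask m (enum S)].
have card_e : #|e| = r.
  by rewrite cardsE (card_uniqP uniq_vs) -(size_map f) -def_u size_tuple.
have sum_e : (\sum_(v in e) f v = 0)%R.
  apply: etrans sum_u; rewrite def_u big_map big_uniq //=.
  by apply: eq_bigl => v; rewrite inE.
have /forall_inP/(_ e) := indS.
rewrite inE card_e sum_e !eqxx => /(_ isT) /negP; apply.
by apply/fintype.subsetP => v; rewrite inE => /mem_mask; rewrite mem_enum.
Qed.

Lemma alpha_zero_sum_rgraph (r s : nat) : 0 < r ->
  zero_sum_forced G r s -> alpha (zero_sum_rgraph r) < s.
Proof.
move=> r_gt0 forced.
(* A maximum over an empty family is 0, so the case of the empty independent set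
   is what makes [s] positive. *)
have ind0 : independent (zero_sum_rgraph r) (finset.set0 : {set V}).
  apply/forall_inP => e; rewrite inE => /andP[/eqP card_e _].
  by rewrite finset.subset0 -cards_eq0 card_e -lt0n.
have s_gt0 := leq_ltn_trans (leq0n _) (independent_zero_sum_rgraph forced ind0).
rewrite -(prednK s_gt0) ltnS; apply/bigmax_leqP => S indS.
by rewrite -ltnS (prednK s_gt0); exact: independent_zero_sum_rgraph indS.
Qed.

(** An edge containing [A] is [A] plus one vertex, whose colour the zero-sum
    condition determines. *)
Lemma Delta_zero_sum_rgraph (r b : nat) : 0 < r ->
    (forall g, #|[set v | f v == g]| <= b) ->
  Delta r.-1 (zero_sum_rgraph r) <= b.
Proof.
move=> r_gt0 le_b; apply/bigmax_leqP => A /eqP cardA.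
pose g := (- \sum_(v in A) f v)%R.
apply: leq_trans (le_b g).
apply: leq_trans (leq_imset_card (fun v => v |: A) _).
apply/subset_leq_card/fintype.subsetP => e.
rewrite inE => /andP[]; rewrite inE => /andP[/eqP card_e /eqP sum_e] subAe.
have /cards1P[v def_v] : #|e :\: A| == 1.
  by rewrite cardsD (finset.setIidPr subAe) card_e cardA -{1}(prednK r_gt0) subSnn.
have def_e : e = v |: A.
  by rewrite -def_v -{1}(finset.setID e A) (finset.setIidPr subAe) finset.setUC.
have vA : v \notin A by have := set11 v; rewrite -def_v inE => /andP[].
apply/finset.imsetP; exists v; last exact: def_e.
rewrite inE /g -addr_eq0.
by move: sum_e; rewrite def_e big_setU1 //= => ->.
Qed.

End ZeroSumHypergraph.

(** Residues mod [#|G|] give a balanced colouring: vertices with the same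
    residue are told apart by their quotient. *)
Lemma balanced_coloring (G : finZmodType) (n : nat) :
  exists f : 'I_n -> G, forall g, #|[set i | f i == g]| <= (n %/ #|G|).+1.
Proof.
have G_gt0 : 0 < #|G| by apply/card_gt0P; exists 0%R.
exists (fun i => enum_val (Ordinal (ltn_pmod i G_gt0))) => g.
pose q (i : 'I_n) : 'I_(n %/ #|G|).+1 := inord (i %/ #|G|).
have qE i : q i = i %/ #|G| :> nat by rewrite inordK // ltnS leq_div2r // ltnW.
rewrite -[leqRHS]card_ord -(@card_in_imset _ _ q) ?max_card // => i j.
rewrite !inE => /eqP <- /eqP/enum_val_inj/(congr1 val)/= eq_mod.
move=> /(congr1 val)/= eq_q; apply: val_inj => /=.
by rewrite (divn_eq i #|G|) (divn_eq j #|G|) eq_mod -!qE eq_q.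
Qed.

Lemma zero_sum_const_forced (G : finZmodType) (r : nat) :
  exponent [set: G] %| r -> zero_sum_forced G r (zero_sum_const G r).
Proof.
move=> /zero_sum_forced_ex ex_s; rewrite /zero_sum_const.
by case: pselect => // ex_s'; case: ex_minnP.
Qed.

Lemma T_codegree_le (n k r : nat) (H : {set {set 'I_n}}) :
  is_rgraph r H -> alpha H < k -> T_codegree n k r <= Delta r.-1 H.
Proof.
move=> rH aH; rewrite /T_codegree; set P := fun H' => _ && _.
(* [arg min] only refers to its default when no candidate exists; here [H] is a
   candidate, so the choice made by [pick] satisfies its specification. *)
rewrite /arg_min /extremum; case: pickP => [H0 /andP[_ /forallP/(_ H)]|no_min].
  by rewrite /P rH aH.
have PH : P H by rewrite /P rH aH.
case: (arg_minnP (P := P) (Delta r.-1) PH) => H0 PH0 minH0.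
have := no_min H0; rewrite /= PH0 /=.
by move/negbT/forallPn => [H1]; rewrite negb_imply => /andP[/minH0 ->].
Qed.

(** [limn] of a divergent sequence is 0, below the bound, so only a convergent
    sequence needs an estimate.  Along the shift [n = i + r] the denominator
    [n - r + 1] is [i + 1], and [n / m + 1] exceeds [(i + 1) / m] by at most the
    constant [c = 1 + r / m], which contributes [c / (i + 1)] to the quotient. *)
Lemma codegree_density_le (R : realType) (k r m : nat) : 0 < m ->
    (forall n, T_codegree n k r <= (n %/ m).+1) ->
  (codegree_density R k r <= 1 / m%:R)%R.
Proof.
move=> m_gt0 leT; rewrite /codegree_density; set u := (fun n : nat => _).
have [cvg_u | dvg_u] := pselect (cvgn u); last first.
  by rewrite (dvgP dvg_u) mul1r invr_ge0 ler0n.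
pose c : R := (1 + r%:R / m%:R)%R.
have cvg_shift : ((fun i => u (i + r)) @ \oo --> limn u)%classic.
  by rewrite cvg_shiftn.
have cvg_bound :
    ((fun i : nat => 1 / m%:R + c * @harmonic R i)%R @ \oo
       --> (1 / m%:R : R)%R)%classic.
  rewrite -[X in (_ --> X)%classic]addr0 -[X in (_ + X)%R](mulr0 c).
  apply: cvgD; first exact: cvg_cst.
  by apply: cvgM; [exact: cvg_cst | exact: cvg_harmonic].
apply: ler_cvg_to cvg_shift cvg_bound _; apply: nearW => i.
rewrite /u /harmonic natrD addrK natr1 ler_pdivrMr ?ltr0Sn //.
have -> : ((1 / m%:R + c / i.+1%:R) * i.+1%:R
           = (i + r)%:R / m%:R + 1 + 1 / m%:R :> R)%R.
  by rewrite /c mulrDl divfK ?pnatr_eq0 // -natr1 natrD; ring.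
apply: le_trans (_ : ((i + r) %/ m).+1%:R <= _)%R; first by rewrite ler_nat.
rewrite -natr1 -addrA lerD //; last by rewrite lerDl divr_ge0.
by rewrite ler_pdivlMr ?ltr0n // -natrM ler_nat leq_divM.
Qed.

Theorem theorem5p1 (R : realType) (G : finZmodType) (r : nat)
    (r_gt0 : 0 < r) (exp_dvd_r : exponent [set: G] %| r) :
  (codegree_density R (zero_sum_const G r) r <= 1 / #|G|%:R)%R.
Proof.
have G_gt0 : 0 < #|G| by apply/card_gt0P; exists 0%R.
apply: codegree_density_le => // n.
have [f le_f] := balanced_coloring G n.
apply: leq_trans (Delta_zero_sum_rgraph r_gt0 le_f).
apply: T_codegree_le; first exact: zero_sum_rgraph_rgraph.
exact: alpha_zero_sum_rgraph (zero_sum_const_forced exp_dvd_r).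
Qed.
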